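(* Let $b,m:[0,\infty)\to\mathbb R$ be continuous and let $\sigma\in(1,2]$ with dual Lebesgue index $\sigma'$, $\frac1\sigma+\frac1{\sigma'}=1$. Suppose that the limits $b_0=\lim_{t\to\infty}(1+t)b(t)$ and $m_0=\lim_{t\to\infty}(1+t)^2m(t)$ exist, that $$\int_1^\infty |t\,b(t)-b_0|^\sigma\,\frac{dt}{t}<\infty,\qquad \int_1^\infty |t^2m(t)-m_0|^\sigma\,\frac{dt}{t}<\infty,$$ and that $4m_0<(b_0-1)^2$. Let $N>0$, and for $\xi\in\mathbb R^n$ let $\mathcal E(t,s,\xi)\in\mathbb C^{2\times2}$ be the fundamental solution of the system $$(1+t)\partial_tU(t,\xi)=\big(A+R(t,\xi)\big)U(t,\xi),$$ $$A=\begin{pmatrix}-1& iN\\ \frac{i m_0}{N}&-b_0\end{pmatrix},\qquad R(t,\xi)=\begin{pmatrix}0&0\\ \frac{i(1+t)^2|\xi|^2+i\left((1+t)^2m(t)-m_0\right)}{N}& b_0-(1+t)b(t)\end{pmatrix},$$ that is, $(1+t)\partial_t\mathcal E(t,s,\xi)=(A+R(t,\xi))\mathcal E(t,s,\xi)$ and $\mathcal E(s,s,\xi)=\mathrm I$. Let $$\mu_+=-\frac{b_0+1}2+\sqrt{\frac{(b_0-1)^2}4-m_0}.$$ Then there are constants $C,C'>0$ such that $$\|\mathcal E(t,s,\xi)\|\le C'\Big(\frac{1+t}{1+s}\Big)^{\mu_+}\exp\left(C\Big(\ln\frac{1+t}{1+s}\Big)^{\frac1{\sigma'}}\right)$$ for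 all $0\le s\le t$ and all $\xi\in\mathbb R^n$ with $(1+t)|\xi|\le N$.
   Context: The system is the first-order form of $\widehat u_{tt}+|\xi|^2\widehat u+b(t)\widehat u_t+m(t)\widehat u=0$ for $U=\big(\frac{N}{1+t}\widehat u,\,-i\partial_t\widehat u\big)^T$. *)

(* Defs.v *)
From HB Require Import structures.
From mathcomp Require Import all_boot all_order all_algebra.
From mathcomp Require Import complex.
From mathcomp Require Import all_classical all_reals all_analysis.

Set Implicit Arguments.
Unset Strict Implicit.
Unset Printing Implicit Defensive.

Import Order.TTheory GRing.Theory Num.Theory numFieldNormedType.Exports.

Local Open Scope classical_set_scope.
Local Open Scope ring_scope.
Local Open Scope complex_scope.

(* Topology and norm of the complex numbers, inherited by the library from the
   modulus; they give matrices over [R[i]] the sup norm of the entries. *)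
HB.instance Definition _ (R : rcfType) := NormedModule.copy R[i] R[i]^o.

(* 2 x 2 matrix with rows (a, b) and (c, d) *)
Definition mx2 (K : Type) (a b c d : K) : 'M[K]_2 :=
  \matrix_(i, j)
    (if i == 0 then (if j == 0 then a else b) else (if j == 0 then c else d)).

(* Euclidean norm; the library norm on ['rV_n] is the sup norm. *)
Definition enorm (R : realType) (n : nat) (xi : 'rV[R]_n) : R :=
  Num.sqrt (\sum_(i < n) xi 0 i ^+ 2).

(* [D] is the derivative at [t] of [F] restricted to [0, +oo[: two-sided for
   t > 0 and one-sided at t = 0. *)
Definition is_deriv_half_line (R : realType) (F : R -> 'M[R[i]]_2) (t : R)
    (D : 'M[R[i]]_2) : Prop :=
  (h^-1)%:C *: (F (t + h) - F t) @[h --> within [set h | 0 <= t + h] 0^'] --> D.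

Definition matA (R : realType) (N b0 m0 : R) : 'M[R[i]]_2 :=
  mx2 (-1)                 ('i%C * N%:C)
      ('i%C * m0%:C / N%:C)  (- b0%:C).

Definition matR (R : realType) (n : nat) (b m : R -> R) (N b0 m0 : R)
    (t : R) (xi : 'rV[R]_n) : 'M[R[i]]_2 :=
  mx2 0 0
      (('i%C * ((1 + t) ^+ 2 * enorm xi ^+ 2)%:C
        + 'i%C * ((1 + t) ^+ 2 * m t - m0)%:C) / N%:C)
      ((b0 - (1 + t) * b t)%:C).

Definition fundamental_solution (R : realType) (n : nat) (b m : R -> R)
    (N b0 m0 : R) (E : R -> R -> 'rV[R]_n -> 'M[R[i]]_2) : Prop :=
  forall (s : R) (xi : 'rV[R]_n), 0 <= s ->
    E s s xi = 1%:M /\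
    forall t : R, 0 <= t ->
      exists2 D : 'M[R[i]]_2,
        is_deriv_half_line (fun tau => E tau s xi) t D &
        (1 + t)%:C *: D = (matA N b0 m0 + matR b m N b0 m0 t xi) *m E t s xi.

(* Main.v *)
Require Import Defs.
From HB Require Import structures.
From mathcomp Require Import all_boot all_order all_algebra complex.
From mathcomp Require Import all_classical all_reals all_analysis.
From mathcomp Require Import measurable_realfun ring lra.

Set Implicit Arguments.
Unset Strict Implicit.
Unset Printing Implicit Defensive.

Import Order.TTheory GRing.Theory Num.Theory numFieldNormedType.Exports.

Local Open Scope classical_set_scope.
Local Open Scope ring_scope.
Local Open Scope complex_scope.

(** For every unit complex number c, the pair (Re (c E_0j), Re (c i E_1j)) solves
    the real system
      (1+t) x' = - x + N y,   (1+t) y' = - (m0/N + r) x + (- b0 + beta) y,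
    whose constant part has the distinct real eigenvalues mu_+ and mu_-.  The sum W
    of the squares of its two eigencoordinates satisfies
      (1+t) W' <= (2 mu_+ + L (|r| + |beta|)) W,
    and Gronwall leaves the integral of (|r| + |beta|) / (1+t) over [s, t] to be
    estimated.  The term with xi contributes at most N / 2 in the zone.  For the others
    Hoelder's inequality is replaced by the elementary f <= d + d^(1-sigma) f^sigma
    with d = (ln ((1+t)/(1+s)))^(-1/sigma), which only needs a bounded primitive of the
    given integrands. *)

(** * Gronwall's inequality and the interpolation inequality for powers *)

(** The product of [W] and [expR (- G)] has nonpositive derivative, hence does not increase.
    Derivatives are asked for in the open interval only and continuity up to the ends, because the
    fundamental solution has only a one-sided derivative at 0. *)
Lemma gronwall (R : realType) (W G W' G' : R -> R) (a b : R) : a <= b ->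
  {within `[a, b], continuous W} -> {within `[a, b], continuous G} ->
  (forall x, a < x < b -> is_derive x 1 W (W' x)) ->
  (forall x, a < x < b -> is_derive x 1 G (G' x)) ->
  (forall x, a < x < b -> W' x <= G' x * W x) ->
  W b <= W a * expR (G b - G a).
Proof.
move=> ab cW cG dW dG le_W'.
pose V x := W x * expR (- G x).
have dV x : a < x < b -> is_derive x 1 V ((W' x - G' x * W x) * expR (- G x)).
  move=> xab; have := dW x xab; have := dG x xab => dGx dWx.
  have dE : is_derive x 1 (fun x => expR (- G x)) (expR (- G x) * - G' x).
    have dNG : is_derive x 1 (fun x => - G x) (- G' x) by exact: is_deriveN.
    exact: (@is_derive1_comp _ expR (fun x => - G x) x _ _ (is_derive_expR _) dNG).
  have := @is_deriveM _ _ W (fun x => expR (- G x)) x 1 _ _ dWx dE.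
  rewrite (_ : W * _ = V)//; move/is_derive_eq; apply.
  by rewrite /GRing.scale /=; ring.
have : V b <= V a.
  apply: (@ler0_derive1_le_cc _ V a b); rewrite ?in_itv/= ?lexx ?ab//.
  - by move=> x; rewrite in_itv/= => /dV [].
  - move=> x; rewrite in_itv/= => xab; rewrite derive1E.
    have [_ ->] := dV x xab.
    by rewrite pmulr_lle0 ?expR_gt0// subr_le0 le_W'.
  - have cE : {within `[a, b], continuous (fun x => expR (- G x))}.
      move=> x; apply: continuous_comp; last exact: continuous_expR.
      by apply: continuousN; exact: cG.
    move=> x; have := cvgM (cW x) (cE x); exact.
move=> VbVa.
have -> : W b = W b * expR (- G b) * expR (G b).
  by rewrite -mulrA -expRD addNr expR0 mulr1.
by rewrite [G b - _]addrC expRD mulrA ler_wpM2r ?expR_ge0.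
Qed.

(** For [f <= d] the first term suffices. Otherwise f = f^(1-sigma) f^sigma, and f^(1-sigma) <=
    d^(1-sigma) because the exponent is nonpositive. *)
Lemma le_powR_interp (R : realType) (sigma d f : R) : 1 <= sigma -> 0 < d -> 0 <= f ->
  f <= d + d `^ (1 - sigma) * f `^ sigma.
Proof.
move=> s1 d0 f0; have [fd|df] := leP f d.
  by rewrite (le_trans fd)// lerDl mulr_ge0// powR_ge0.
have f0' : 0 < f by exact: lt_trans df.
apply: (@le_trans _ _ (d `^ (1 - sigma) * f `^ sigma)); last by rewrite lerDr ltW.
rewrite -[leLHS]mulr1 -{1}(powRr1 f0) -{1}(subrK sigma 1) powRD; last first.
  by rewrite (gt_eqF f0') implybT.
rewrite mulr1 ler_pM2r ?powR_gt0//.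
rewrite -[1 - _]opprB !powRN lef_pV2 ?posrE ?powR_gt0//.
by rewrite ge0_ler_powR ?nnegrE ?(ltW df) ?subr_ge0// ltW.
Qed.

(** For L > 0 the choice d = L^(-1/sigma) makes both d L and d^(1-sigma) equal to L^(1-1/sigma),
    which is L^(1/sigma'). The extra [+ M] absorbs the case [L = 0], where [d] is taken to be 1. *)
Lemma interp_optimum (R : realType) (sigma sigma' L M : R) :
  1 < sigma -> sigma^-1 + sigma'^-1 = 1 -> 0 <= L -> 0 <= M ->
  exists2 d, 0 < d & d * L + d `^ (1 - sigma) * M <= (1 + M) * L `^ sigma'^-1 + M.
Proof.
move=> s1 ss' L0 M0; have s0 : 0 < sigma by exact: lt_trans s1.
have -> : sigma'^-1 = 1 - sigma^-1 by rewrite -ss' addrC addKr.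
have [->|Ln0] := eqVneq L 0.
  exists 1 => //; rewrite mulr0 powR1 mul1r add0r lerDr mulr_ge0 ?powR_ge0//.
  by rewrite addr_ge0.
have Lp : 0 < L by rewrite lt_def Ln0.
exists (L `^ (- sigma^-1)); first exact: powR_gt0.
rewrite -{2}(powRr1 L0) -powRD; last by rewrite Ln0 implybT.
rewrite -powRrM [- _ + 1]addrC.
have -> : - sigma^-1 * (1 - sigma) = 1 - sigma^-1.
  by field; rewrite gt_eqF.
by rewrite mulrDl mul1r [_ * M]mulrC lerDl.
Qed.

(** * Bounded primitives that dominate the remainders *)

(** Extends a coefficient given on a half line by its value at [a], so that later lemmas can work
    with functions continuous on the whole line. *)
Lemma continuous_clamp (R : realType) (a : R) (f : R -> R) :
  {within `[a, +oo[, continuous f} -> continuous (fun t => f (Num.max a t)).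
Proof.
move=> /subspace_continuousP cf t.
have at_ : (`[a, +oo[%classic : set R) (Num.max a t).
  by rewrite /= in_itv/= andbT le_max lexx.
apply: cvg_comp (cf _ at_) => U /= wU.
have cmax : {for t, continuous (cst a \max (@id R))}.
  by apply: continuous_max; [exact: cst_continuous|exact: cvg_id].
have := cmax _ wU; apply: (@filterS _ (nbhs t)) => s; apply.
by rewrite /= in_itv/= andbT le_max lexx.
Qed.

(** [F] is the integral from [c] and [M] the total integral over [[c, +oo[], finite since only a
    compact piece is added to [[a, +oo[]. Starting at [c < a] makes [F] differentiable on both sides
    at [a] and at points to its left. *)
Lemma bounded_primitive (R : realType) (k : R -> R) (c a : R) : c < a ->
  continuous k -> (forall t, 0 <= k t) ->
  (\int[lebesgue_measure]_(t in `[a, +oo[) (k t)%:E < +oo)%E ->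
  exists F M, forall t, c < t -> is_derive t 1 F (k t) /\ 0 <= F t <= M.
Proof.
move=> ca ck k0 kint.
have ik u v : lebesgue_measure.-integrable `[u, v] (EFin \o k).
  apply: continuous_compact_integrable; first exact: segment_compact.
  exact: continuous_subspaceT.
have mk (D : set R) : measurable D -> measurable_fun D (EFin \o k).
  move=> mD; apply/measurable_EFinP; apply: subspace_continuous_measurable_fun => //.
  exact: continuous_subspaceT.
have fin_c u : (\int[lebesgue_measure]_(t in `[c, u]) (k t)%:E < +oo)%E.
  have /integrableP[_] := ik c u; congr (_ < _)%E.
  by apply: eq_integral => t _ /=; rewrite ger0_norm.
have fin_all : (\int[lebesgue_measure]_(t in `[c, +oo[) (k t)%:E < +oo)%E.
  have -> : (`[c, +oo[ = `[c, a[ `|` `[a, +oo[ :> set R)%classic.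
    by rewrite -itv_bndbnd_setU// bnd_simp// ltW.
  have := @ge0_integral_setU _ _ R (@lebesgue_measure R) `[c, a[%classic
    `[a, +oo[%classic (measurable_itv _) (measurable_itv _) (EFin \o k).
  move=> /= ->.
  - rewrite lte_add_pinfty//; apply: le_lt_trans (fin_c a).
    apply: ge0_subset_integral => //; first exact: mk.
      by move=> *; rewrite lee_fin.
    by apply: subset_itvl; rewrite bnd_simp.
  - by apply: mk; apply: measurableU.
  - by move=> *; rewrite lee_fin.
  - apply/disj_setPS => t [] /=; rewrite !in_itv/= andbT => /andP[_ ta] at_.
    by rewrite leNgt ta in at_.
exists (fun t => Rintegral lebesgue_measure `[c, t] k),
  (fine (\int[lebesgue_measure]_(t in `[c, +oo[) (k t)%:E)%E).
move=> t ct; split.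
  have tt1 : t < t + 1 by rewrite ltrDl.
  have [dF F't] := @continuous_FTC1_closed _ k c t _ tt1 (ik _ _) ct (ck t).
  by apply: DeriveDef => //; rewrite -derive1E.
have pos (D : set R) : (0 <= \int[lebesgue_measure]_(t in D) (k t)%:E)%E.
  by apply: integral_ge0 => *; rewrite lee_fin.
rewrite /Rintegral fine_ge0//=; apply: fine_le.
- by rewrite ge0_fin_numE.
- by rewrite ge0_fin_numE.
apply: ge0_subset_integral => //; first exact: mk.
  by move=> *; rewrite lee_fin.
by apply: subset_itvl; rewrite bnd_simp.
Qed.

Lemma cvg_pinfty_bounded (R : realType) (f : R -> R) (a l : R) :
  continuous f -> f t @[t --> +oo] --> l ->
  exists2 B, 0 <= B & forall t, a <= t -> `|f t| <= B.
Proof.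
move=> cf fl; have : `|l| < `|l| + 1 by rewrite ltrDl.
move=> /(cvgr_norm_le _ fl)[T [_ hT]].
have [] := @EVT_max R (fun t => `|f t|) a (Num.max a T).
- by rewrite le_max lexx.
- apply: continuous_subspaceT => t.
  by apply: continuous_comp; [exact: cf|exact: norm_continuous].
move=> s _ hs; exists (`|f s| + (`|l| + 1)) => [|t at_].
  by rewrite !addr_ge0.
have [tT|Tt] := leP t T.
  apply: (@le_trans _ _ `|f s|); last by rewrite lerDl addr_ge0.
  by apply: hs; rewrite in_itv/= at_ le_max tT orbT.
by rewrite (le_trans (hT _ Tt))// lerDr.
Qed.

(** The bound (1+t)^k - t^k <= k (1+t)^(k-1), multiplied by 1+t to avoid the exponent k-1. It pays
    for passing from the weight t^k of the integral hypotheses to the weight (1+t)^k of the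
    system. *)
Lemma exprD1_sub_le (R : realDomainType) (t : R) (k : nat) : 0 <= t ->
  ((1 + t) ^+ k - t ^+ k) * (1 + t) <= k%:R * (1 + t) ^+ k.
Proof.
move=> t0; elim: k => [|k IH]; first by rewrite !expr0 subrr !mul0r.
have t1 : 0 <= 1 + t by rewrite addr_ge0.
have le_tk : t ^+ k <= (1 + t) ^+ k by rewrite lerXn2r ?nnegrE// lerDr.
have -> : ((1 + t) ^+ k.+1 - t ^+ k.+1) * (1 + t) =
    (1 + t) * (((1 + t) ^+ k - t ^+ k) * (1 + t)) + (1 + t) * t ^+ k.
  by rewrite !exprS; ring.
rewrite [leRHS](_ : _ = (1 + t) * (k%:R * (1 + t) ^+ k) + (1 + t) * (1 + t) ^+ k).
  by rewrite lerD// ler_wpM2l.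
by rewrite -natr1 exprS; ring.
Qed.

Lemma continuous_powR_norm (R : realType) (p : R) : 0 < p ->
  continuous (fun x : R => `|x| `^ p).
Proof.
move=> p0 x; have [->|x0] := eqVneq x 0; last first.
  apply: (@continuous_comp _ _ _ (fun x : R => `|x|) (fun x => x `^ p)).
    exact: norm_continuous.
  have [|dp _] := @is_derive1_powR R p `|x|; first by rewrite normr_gt0.
  exact/differentiable_continuous/derivable1_diffP.
apply/cvgrPdist_lt => e e0.
have ep : 0 < e `^ p^-1 by exact: powR_gt0.
exists (e `^ p^-1) => //= y /=; rewrite ?sub0r ?normrN => ye.
rewrite normr0 powR0 ?gt_eqF// sub0r normrN ger0_norm ?powR_ge0//.
rewrite -[ltRHS](powRr1 (ltW e0)) -(mulVf (lt0r_neq0 p0)) powRrM.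
by rewrite gt0_ltr_powR ?nnegrE ?powR_ge0.
Qed.

(** For t >= 1 the remainder splits into [g t], handled by interpolation, and the change of weight,
    which after division by 1+t is of order (1+t)^(-2). For t < 1 a uniform bound is enough. [F],
    [M] and [K] are fixed before [d], which will later depend on the interval. *)
Lemma scaled_remainder_bound (R : realType) (k : nat) (c : R -> R) (c0 sigma : R) :
  1 < sigma -> continuous c -> (1 + t) ^+ k * c t @[t --> +oo] --> c0 ->
  (\int[lebesgue_measure]_(t in `[1%R, +oo[)
     (`|t ^+ k * c t - c0| `^ sigma / t)%:E < +oo)%E ->
  exists (F F' : R -> R) (M K : R), 0 <= K /\ forall t : R, 0 <= t ->
    [/\ is_derive t 1 F (F' t), 0 <= F t <= M & forall d, 0 < d ->
      `|(1 + t) ^+ k * c t - c0| / (1 + t) <=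
        d / (1 + t) + d `^ (1 - sigma) * F' t + K / (1 + t) ^+ 2].
Proof.
move=> s1 cc lim_c int_c; have s0 : 0 < sigma by exact: lt_trans s1.
pose g t := t ^+ k * c t - c0.
pose h t := `|g t| `^ sigma / t.
(* Freezing [h] to the left of 1 keeps the integrand continuous, away from the singularity of 1/t at
   0. *)
pose F' t := h (Num.max 1 t).
have cX (e : R) : continuous (fun t => (e + t) ^+ k * c t).
  move=> t; apply: cvgM (cc t).
  apply: (@continuous_comp _ _ _ (fun t => e + t) (fun x => x ^+ k)).
    by apply: cvgD; [exact: cvg_cst|exact: cvg_id].
  exact: exprn_continuous.
have cg : continuous g.
  move=> t; apply: cvgB; last exact: cvg_cst.
  apply: cvgM (cc t); exact: exprn_continuous.
have [B B0 hB] : exists2 B, 0 <= B &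
    forall t, 0 <= t -> `|(1 + t) ^+ k * c t - c0| <= B.
  apply: (@cvg_pinfty_bounded _ _ _ (c0 - c0)).
    by move=> t; apply: cvgB; [exact: cX|exact: cvg_cst].
  by apply: cvgB; [exact: lim_c|exact: cvg_cst].
have max_gt0 t : 0 < Num.max 1 t :> R by rewrite lt_max ltr01.
have F'0 t : 0 <= F' t by rewrite /F' /h divr_ge0 ?powR_ge0// ltW.
have F'E t : 1 <= t -> F' t = h t by move=> t1; rewrite /F' (max_idPr t1).
have cF' : continuous F'.
  move=> t; have cmax : {for t, continuous (cst 1 \max (@id R))}.
    by apply: continuous_max; [exact: cst_continuous|exact: cvg_id].
  apply: (@continuous_comp _ _ _ _ h) cmax _ => /=.
  apply: cvgM; last by apply: cvgV; [rewrite gt_eqF|exact: cvg_id].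
  apply: (@continuous_comp _ _ _ g (fun x => `|x| `^ sigma)); first exact: cg.
  exact: continuous_powR_norm s0 _.
have int_F' : (\int[lebesgue_measure]_(t in `[1%R, +oo[) (F' t)%:E < +oo)%E.
  congr (_ < _)%E: int_c; apply: eq_integral => t.
  by rewrite inE/= in_itv/= andbT => t1; rewrite F'E.
(* The primitive starts at -1 so that 0 is interior and [F] has a two-sided derivative there. *)
have N11 : -1 < 1 :> R by lra.
have [F [M hF]] := bounded_primitive N11 cF' F'0 int_F'.
(* The first summand of [K] bounds the change of weight when t >= 1; the second covers t < 1, where
   1/(1+t) <= 2/(1+t)^2. *)
exists F, F', M, (k%:R * (B + `|c0|) + 2 * B); split.
  by rewrite addr_ge0 ?mulr_ge0 ?addr_ge0.
move=> t t0; have [|dF bF] := hF t; first by lra.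
split=> // d d0.
have t1p : 0 < 1 + t by rewrite ltr_pwDl.
have d10 : 0 <= d `^ (1 - sigma) := powR_ge0 _ _.
have [t1|t1] := leP 1 t; last first.
  have fB := hB _ t0.
  have -> : d / (1 + t) + d `^ (1 - sigma) * F' t +
      (k%:R * (B + `|c0|) + 2 * B) / (1 + t) ^+ 2 =
    2 * B / (1 + t) ^+ 2 + (d / (1 + t) + d `^ (1 - sigma) * F' t +
      k%:R * (B + `|c0|) / (1 + t) ^+ 2) by ring.
  have B2 : B / (1 + t) <= 2 * B / (1 + t) ^+ 2.
    rewrite ler_pdivrMr// [leRHS](_ : _ = B * (2 / (1 + t))).
      by rewrite ler_peMr// ler_pdivlMr// mul1r -[2]/(1 + 1) lerD2l ltW.
    by field; rewrite gt_eqF.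
  apply: (le_trans _ (lerD B2 (lexx _))).
  rewrite -[leLHS]addr0 lerD//; first by rewrite ler_wpM2r// invr_ge0 ltW.
  by rewrite !addr_ge0// ?mulr_ge0 ?addr_ge0// ?invr_ge0 ?exprn_ge0// ltW.
have t0' : 0 < t by exact: lt_le_trans t1.
have fg : (1 + t) ^+ k * c t - c0 = g t + ((1 + t) ^+ k - t ^+ k) * c t.
  by rewrite /g; ring.
have c_le : `|((1 + t) ^+ k - t ^+ k) * c t| / (1 + t) <=
    k%:R * (B + `|c0|) / (1 + t) ^+ 2.
  rewrite ler_pdivrMr// [leRHS](_ : _ = k%:R * (B + `|c0|) / (1 + t)); last first.
    by field; rewrite gt_eqF.
  rewrite ler_pdivlMr// normrM ger0_norm; last first.
    by rewrite subr_ge0 lerXn2r ?nnegrE ?lerDr// ltW.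
  (* What remains after the change of weight is k (1+t)^k |c t|, and (1+t)^k c t differs from [c0]
     by at most [B]. *)
  rewrite mulrAC; apply: le_trans (ler_wpM2r (normr_ge0 _) (exprD1_sub_le k t0)) _.
  rewrite -mulrA ler_wpM2l// -[X in X * _]ger0_norm ?exprn_ge0 ?(ltW t1p)//.
  rewrite -normrM -[X in `|X|](subrK c0); apply: le_trans (ler_normD _ _) _.
  by rewrite lerD2r hB.
rewrite fg; apply: (@le_trans _ _ ((`|g t| + `|((1 + t) ^+ k - t ^+ k) * c t|) / (1 + t))).
  by rewrite ler_wpM2r ?invr_ge0 ?(ltW t1p)// ler_normD.
rewrite mulrDl; apply: lerD; last first.
  apply: le_trans c_le _.
  by rewrite ler_wpM2r ?invr_ge0 ?exprn_ge0 ?(ltW t1p)// lerDl mulr_ge0.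
apply: le_trans (_ : (d + d `^ (1 - sigma) * `|g t| `^ sigma) / (1 + t) <= _).
  by rewrite ler_wpM2r ?invr_ge0 ?(ltW t1p)// le_powR_interp// ltW.
rewrite mulrDl lerD2l F'E// /h mulrA ler_wpM2l ?mulr_ge0 ?powR_ge0//.
by rewrite lef_pV2 ?posrE// lerDr.
Qed.

(** * Energy estimate for the real planar system *)

Lemma is_derive_1D (R : realType) (u : R) : is_derive u 1 (fun u => 1 + u) 1.
Proof.
have := is_deriveD (is_derive_cst (1 : R) u 1) (is_derive_id u 1).
by move/is_derive_eq; apply; rewrite add0r.
Qed.

Lemma is_derive_ln1D (R : realType) (u : R) : 0 <= u ->
  is_derive u 1 (fun u => ln (1 + u)) (1 + u)^-1.
Proof.
move=> u0; have u1 : 0 < 1 + u by lra.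
have := is_derive1_comp (is_derive1_ln u1) (is_derive_1D u).
by move/is_derive_eq; apply; rewrite mulr1.
Qed.

Lemma is_derive_sqr (R : realType) (f : R -> R) (u df : R) :
  is_derive u 1 f df -> is_derive u 1 (fun u => f u ^+ 2) (2 * f u * df).
Proof.
move=> df_u; have := is_deriveM df_u df_u; set g := (_ * _)%R.
have -> : g = (fun u => f u ^+ 2) by apply/funext => v; rewrite expr2.
by move/is_derive_eq; apply; rewrite /GRing.scale/=; ring.
Qed.

Lemma is_derive_sqr_lin (R : realType) (p q x1 y1 u : R) (x y : R -> R) :
  is_derive u 1 x x1 -> is_derive u 1 y y1 ->
  is_derive u 1 (fun u => (p * x u + q * y u) ^+ 2)
    (2 * (p * x u + q * y u) * (p * x1 + q * y1)).
Proof.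
by move=> dx dy; apply: is_derive_sqr.
Qed.

(** The difference of the two sides is a positive combination of two squares. For [p != q] this
    bounds the solution by its eigencoordinates. *)
Lemma sum_sqr_le_eigen (R : realFieldType) (N p q a b : R) : N != 0 ->
  ((p - q) ^+ 2 / 2) * (a ^+ 2 + b ^+ 2) <=
  (1 + (p ^+ 2 + q ^+ 2) / (2 * N ^+ 2)) *
    ((p * a + N * b) ^+ 2 + (q * a + N * b) ^+ 2).
Proof.
move=> N0; rewrite -subr_ge0.
have -> : (1 + (p ^+ 2 + q ^+ 2) / (2 * N ^+ 2)) *
    ((p * a + N * b) ^+ 2 + (q * a + N * b) ^+ 2) - ((p - q) ^+ 2 / 2) * (a ^+ 2 + b ^+ 2) =
      ((p + q) * a + 2 * N * b) ^+ 2 / 2 +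
      (p * (p * a + N * b) + q * (q * a + N * b)) ^+ 2 / (2 * N ^+ 2) by field.
by rewrite addr_ge0// divr_ge0 ?sqr_ge0// mulr_ge0 ?sqr_ge0.
Qed.

(** Cauchy-Schwarz for each coordinate, with the defect given by Lagrange's identity. *)
Lemma eigen_le_sum_sqr (R : realFieldType) (N p q a b : R) :
  (p * a + N * b) ^+ 2 + (q * a + N * b) ^+ 2 <=
  (p ^+ 2 + q ^+ 2 + 2 * N ^+ 2) * (a ^+ 2 + b ^+ 2).
Proof.
rewrite -subr_ge0.
have -> : (p ^+ 2 + q ^+ 2 + 2 * N ^+ 2) * (a ^+ 2 + b ^+ 2) -
    ((p * a + N * b) ^+ 2 + (q * a + N * b) ^+ 2) =
      (N * a - p * b) ^+ 2 + (N * a - q * b) ^+ 2 by ring.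
by rewrite addr_ge0 ?sqr_ge0.
Qed.

(** The left side is the contribution of the remainder to the derivative of the energy. For each
    coefficient, with D = N d, it follows from 2 (z1 + z2) D <= (z1 + z2)^2 + D^2 and (z1 + z2)^2 <=
    2 (z1^2 + z2^2). *)
Lemma perturbation_le (R : realFieldType) (N r beta a b z1 z2 : R) : 0 < N ->
  2 * (z1 + z2) * (N * (- r * a + beta * b)) <=
  (`|r| + `|beta|) * (2 * (z1 ^+ 2 + z2 ^+ 2) + 2 * N ^+ 2 * (a ^+ 2 + b ^+ 2)).
Proof.
move=> N0.
have key c d : 2 * (z1 + z2) * (N * (c * d)) <=
    `|c| * (2 * (z1 ^+ 2 + z2 ^+ 2) + N ^+ 2 * d ^+ 2).
  have -> : 2 * (z1 + z2) * (N * (c * d)) = c * (2 * (z1 + z2) * (N * d)) by ring.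
  apply: le_trans (ler_norm _) _; rewrite normrM ler_wpM2l// ler_norml.
  have -> : N ^+ 2 * d ^+ 2 = (N * d) ^+ 2 by ring.
  have := sqr_ge0 (z1 + z2 - N * d); have := sqr_ge0 (z1 + z2 + N * d).
  have := sqr_ge0 (z1 - z2); rewrite !expr2; move: (N * d) => D *; apply/andP; split; nra.
have := lerD (key (- r) a) (key beta b); rewrite normrN.
have -> : 2 * (z1 + z2) * (N * (- r * a)) + 2 * (z1 + z2) * (N * (beta * b)) =
  2 * (z1 + z2) * (N * (- r * a + beta * b)) by ring.
move=> /le_trans; apply; rewrite [leRHS]mulrDl.
have := mulr_ge0 (sqr_ge0 N) (sqr_ge0 b); have := mulr_ge0 (sqr_ge0 N) (sqr_ge0 a).
by move=> Na Nb; apply: lerD; rewrite ler_wpM2l// lerD2l; lra.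
Qed.

(** The eigenvalues enter through trace and determinant. [K] and [L] are chosen before the functions
    and the interval, which yields uniformity in s, t and xi. *)
Lemma planar_system_bound (R : realType) (N b0 m0 mu1 mu2 : R) :
  0 < N -> mu2 < mu1 -> mu1 + mu2 = - (b0 + 1) -> mu1 * mu2 = b0 + m0 ->
  exists K L : R, [/\ 0 < K, 0 < L & forall (x y H x' y' H' r beta : R -> R) (s t : R),
    0 <= s -> s <= t ->
    {within `[s, t], continuous x} -> {within `[s, t], continuous y} ->
    {within `[s, t], continuous H} ->
    (forall u, s < u < t -> [/\ is_derive u 1 x (x' u), is_derive u 1 y (y' u) &
                               is_derive u 1 H (H' u)]) ->
    (forall u, s < u < t ->
      [/\ (1 + u) * x' u = - x u + N * y u,
          (1 + u) * y' u = - (m0 / N + r u) * x u + (- b0 + beta u) * y u &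
          (`|r u| + `|beta u|) / (1 + u) <= H' u]) ->
    x t ^+ 2 + y t ^+ 2 <=
      (K * ((1 + t) / (1 + s)) `^ mu1 * expR (L * (H t - H s))) ^+ 2 *
        (x s ^+ 2 + y s ^+ 2)].
Proof.
move=> N0 mu21 tr det.
have N00 : N != 0 by rewrite gt_eqF.
(* (p, N) and (q, N) are left eigenvectors of the matrix ((-1, N), (-m0/N, -b0)).
   They are kept opaque: field is very slow on local definitions. *)
have [p pE] : exists p, p = mu1 + b0 by exists (mu1 + b0).
have [q qE] : exists q, q = mu2 + b0 by exists (mu2 + b0).
have pq0 : 0 < (p - q) ^+ 2 / 2 by rewrite divr_gt0// exprn_gt0//; lra.
have [Kx Kx0 w_ge] : exists2 Kx, 0 < Kx & forall a b,
    a ^+ 2 + b ^+ 2 <= Kx * ((p * a + N * b) ^+ 2 + (q * a + N * b) ^+ 2).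
  exists ((1 + (p ^+ 2 + q ^+ 2) / (2 * N ^+ 2)) / ((p - q) ^+ 2 / 2)).
    rewrite divr_gt0// ltr_pwDl// divr_ge0 ?addr_ge0 ?sqr_ge0//.
    by rewrite mulr_ge0// sqr_ge0.
  move=> a b; rewrite mulrAC ler_pdivlMr// mulrC; exact: sum_sqr_le_eigen.
have [Kw Kw0 w_le] : exists2 Kw, 0 < Kw & forall a b,
    (p * a + N * b) ^+ 2 + (q * a + N * b) ^+ 2 <= Kw * (a ^+ 2 + b ^+ 2).
  exists (p ^+ 2 + q ^+ 2 + 2 * N ^+ 2); last by move=> *; exact: eigen_le_sum_sqr.
  by rewrite ltr_wpDl ?addr_ge0 ?sqr_ge0// mulr_gt0// exprn_gt0.
(* The 2 comes from the eigencoordinates in [perturbation_le]; the other term converts its a^2 + b^2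
   into energy by means of [Kx]. *)
pose L := 2 + 2 * N ^+ 2 * Kx.
have L0 : 0 < L by rewrite /L ltr_pwDl// mulr_ge0 ?(ltW Kx0)// mulr_ge0 ?sqr_ge0.
exists (Num.sqrt (Kx * Kw)), (L / 2); split.
- by rewrite sqrtr_gt0 mulr_gt0.
- by rewrite divr_gt0.
move=> x y H x' y' H' r beta s t s0 st cx cy cH dxyH sys.
pose W u := (p * x u + N * y u) ^+ 2 + (q * x u + N * y u) ^+ 2.
pose W' u := 2 * (p * x u + N * y u) * (p * x' u + N * y' u) +
             2 * (q * x u + N * y u) * (q * x' u + N * y' u).
pose G u := 2 * mu1 * ln (1 + u) + L * H u.
pose G' u := 2 * mu1 / (1 + u) + L * H' u.
have cZ k : {within `[s, t], continuous (fun u => k * x u + N * y u)}.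
  move=> u; apply: cvgD; apply: cvgM; [exact: cvg_cst|exact: cx|exact: cvg_cst|exact: cy].
have cln : {within `[s, t], continuous (fun u => ln (1 + u))}.
  apply: derivable_within_continuous => u; rewrite in_itv/= => /andP[su _].
  by have [] := is_derive_ln1D (le_trans s0 su).
have WG : W t <= W s * expR (G t - G s).
  apply: (@gronwall R W G W' G') => //.
  - move=> u; have := cvgD (cvgM (cZ p u) (cZ p u)) (cvgM (cZ q u) (cZ q u)); exact.
  - move=> u; apply: cvgD; apply: cvgM; [exact: cvg_cst|exact: cln|exact: cvg_cst|exact: cH].
  - move=> u sut; have [dx dy _] := dxyH u sut.
    have := is_deriveD (is_derive_sqr_lin p N dx dy) (is_derive_sqr_lin q N dx dy).
    exact.
  - move=> u sut; have [_ _ dH] := dxyH u sut.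
    have dlnu : is_derive u 1 (fun u => ln (1 + u)) (1 + u)^-1.
      by apply: is_derive_ln1D; lra.
    have := is_deriveD (is_deriveZ (2 * mu1) dlnu) (is_deriveZ L dH).
    exact.
  move=> u sut; have [ex ey hr] := sys u sut.
  have u1 : 0 < 1 + u by lra.
  rewrite /W' /G' /W.
  move: (x u) (y u) (x' u) (y' u) (H' u) (r u) (beta u) ex ey hr.
  move=> X Y X1 Y1 H1 r1 be1 ex ey hr.
  pose z1 := p * X + N * Y; pose z2 := q * X + N * Y.
  have w0 : 0 <= z1 ^+ 2 + z2 ^+ 2 by rewrite addr_ge0 ?sqr_ge0.
  (* The constant part becomes diagonal in the eigencoordinates. The remainder enters only the
     equation for y, so both coordinates receive the same perturbation. *)
  have e1 : (1 + u) * (p * X1 + N * Y1) = mu1 * z1 + N * (- r1 * X + be1 * Y).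
    rewrite mulrDr mulrCA ex [X in _ + X]mulrCA ey /z1 pE.
    rewrite [N * (_ + _ * Y)](_ : _ = - (m0 * X) + N * (- r1 * X + (- b0 + be1) * Y)).
      have -> : m0 = mu1 * mu2 - b0 by rewrite det; ring.
      have -> : b0 = - (mu1 + mu2) - 1 by rewrite tr; ring.
      by ring.
    by field.
  have e2 : (1 + u) * (q * X1 + N * Y1) = mu2 * z2 + N * (- r1 * X + be1 * Y).
    rewrite mulrDr mulrCA ex [X in _ + X]mulrCA ey /z2 qE.
    rewrite [N * (_ + _ * Y)](_ : _ = - (m0 * X) + N * (- r1 * X + (- b0 + be1) * Y)).
      have -> : m0 = mu1 * mu2 - b0 by rewrite det; ring.
      have -> : b0 = - (mu1 + mu2) - 1 by rewrite tr; ring.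
      by ring.
    by field.
  rewrite -(ler_pM2l u1) -/z1 -/z2.
  have -> : (1 + u) * (2 * z1 * (p * X1 + N * Y1) + 2 * z2 * (q * X1 + N * Y1)) =
     2 * mu1 * z1 ^+ 2 + 2 * mu2 * z2 ^+ 2 + 2 * (z1 + z2) * (N * (- r1 * X + be1 * Y)).
    rewrite [LHS](_ : _ = 2 * z1 * ((1 + u) * (p * X1 + N * Y1)) +
      2 * z2 * ((1 + u) * (q * X1 + N * Y1))); last by ring.
    by rewrite e1 e2; ring.
  have -> : (1 + u) * ((2 * mu1 / (1 + u) + L * H1) * (z1 ^+ 2 + z2 ^+ 2)) =
      2 * mu1 * (z1 ^+ 2 + z2 ^+ 2) + (1 + u) * H1 * (L * (z1 ^+ 2 + z2 ^+ 2)).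
    by field; rewrite gt_eqF.
  (* The main part uses [mu2 < mu1] to replace the smaller eigenvalue by the larger one. *)
  apply: lerD.
    by rewrite [leRHS]mulrDr lerD2l ler_wpM2r ?sqr_ge0// ler_pM2l// ltW.
  apply: le_trans (perturbation_le _ _ _ _ _ _ N0) _.
  rewrite ler_pdivrMr// mulrC in hr.
  apply: ler_pM => //.
    by apply: addr_ge0; rewrite mulr_ge0// ?addr_ge0 ?sqr_ge0// mulr_ge0 ?sqr_ge0.
  rewrite /L [leRHS]mulrDl lerD2l -[leRHS]mulrA ler_wpM2l//.
  by rewrite mulr_ge0 ?sqr_ge0.
have W_ge := w_ge (x t) (y t).
have W_le := w_le (x s) (y s).
apply: le_trans W_ge _.
apply: (@le_trans _ _ (Kx * (W s * expR (G t - G s)))); first by rewrite ler_wpM2l// ltW.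
apply: (@le_trans _ _ (Kx * ((Kw * (x s ^+ 2 + y s ^+ 2)) * expR (G t - G s)))).
  by rewrite ler_wpM2l ?(ltW Kx0)// ler_wpM2r ?expR_ge0.
have s1 : 0 < 1 + s by lra.
have t1 : 0 < 1 + t by lra.
(* The energy is quadratic, so the rate 2 mu1 and the constant [L] are halved when a square is
   extracted. *)
have -> : expR (G t - G s) = (((1 + t) / (1 + s)) `^ mu1 * expR (L / 2 * (H t - H s))) ^+ 2.
  rewrite /powR gt_eqF ?divr_gt0// -expRD -expRM_natl ln_div ?posrE//; congr expR.
  by rewrite /G; field.
rewrite -[in leRHS]mulrA [in leRHS]exprMn sqr_sqrtr ?mulr_ge0 ?(ltW Kx0) ?(ltW Kw0)//.
by rewrite le_eqVlt; apply/orP; left; apply/eqP; ring.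
Qed.

(** * From matrix derivatives on the half line to real functions *)

Lemma Re_normc_le (R : realType) (z : R[i]) : `|complex.Re z|%:C <= `|z|.
Proof. by rewrite normc_def lecR -sqrtr_sqr ler_wsqrtr// lerDl sqr_ge0. Qed.

(** Taking the real part after multiplication by a unit complex number does not increase distances.
    The epsilon-delta form serves both the two-sided derivative at t > 0 and the continuity at t =
    0. *)
Lemma half_line_quotient_cvg (R : realType) (F : R -> 'M[R[i]]_2) (t : R)
    (D : 'M[R[i]]_2) (c : R[i]) (i j : 'I_2) (e : R) :
  `|c| = 1 -> is_deriv_half_line F t D -> 0 < e ->
  exists2 d, 0 < d & forall h, `|h| < d -> h != 0 -> 0 <= t + h ->
    `|complex.Re (c * D i j) - h^-1 * (complex.Re (c * F (t + h) i j) - complex.Re (c * F t i j))| < e.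
Proof.
move=> c1 dF e0.
have e0C : 0 < e%:C :> R[i] by rewrite ltcR.
have := cvg_comp _ _ dF (@coord_continuous R[i] 2 2 i j D).
move=> /cvgrPdist_lt/(_ _ e0C)[d d0 hd]; exists d => // h hlt h0 th.
have := hd h; rewrite /= sub0r normrN => /(_ hlt h0 th); rewrite !mxE => hh.
rewrite -ltcR; apply: le_lt_trans hh.
rewrite -[leRHS]mul1r -c1 -normrM; apply: le_trans (Re_normc_le _).
rewrite lecR le_eqVlt; apply/orP; left; apply/eqP; congr `|_|.
case: c c1 (D i j) (F t i j) (F (t + h) i j) => [c1 c2] _ [a1 a2] [a3 a4] [a5 a6] /=.
by simpc; rewrite /=; ring.
Qed.

Lemma half_line_is_derive (R : realType) (F : R -> 'M[R[i]]_2) (t : R)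
    (D : 'M[R[i]]_2) (c : R[i]) (i j : 'I_2) :
  `|c| = 1 -> is_deriv_half_line F t D -> 0 < t ->
  is_derive t 1 (fun u => complex.Re (c * F u i j)) (complex.Re (c * D i j)).
Proof.
move=> c1 dF t0; pose x u := complex.Re (c * F u i j).
have lim_x : h^-1 *: (x (h *: 1 + t) - x t) @[h --> 0^'] --> complex.Re (c * D i j).
  apply/cvgrPdist_lt => e e0.
  have [d d0 hd] := half_line_quotient_cvg i j c1 dF e0.
  (* A radius of at most [t] keeps [t + h] nonnegative, so the restriction to the half line is
     void. *)
  exists (Num.min d t); first by rewrite /= lt_min d0.
  move=> h; rewrite /= sub0r normrN lt_min => /andP[hlt ht] h0.
  rewrite [h *: 1]mulr1 [h + t]addrC; apply: hd => //.
  by move: ht; rewrite ltr_norml; lra.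
by apply: DeriveDef; [apply/cvg_ex; exists (complex.Re (c * D i j)) | apply: cvg_lim].
Qed.

Lemma half_line_continuous (R : realType) (F D : R -> 'M[R[i]]_2) (c : R[i])
    (i j : 'I_2) :
  `|c| = 1 -> (forall t, 0 <= t -> is_deriv_half_line F t (D t)) ->
  {within `[0, +oo[, continuous (fun u => complex.Re (c * F u i j))}.
Proof.
move=> c1 dF; apply/subspace_continuousP => t; rewrite /= in_itv/= andbT => t0.
(* Tolerance 1 suffices: near [t] the difference quotient is bounded by [|a| + 1], which gives a
   Lipschitz estimate at [t], including t = 0. *)
have [d d0 hd] := half_line_quotient_cvg i j c1 (dF t t0) (@ltr01 R).
set a := complex.Re (c * D t i j) in hd.
apply/cvgrPdist_lt => e e0.
have a1 : 0 < `|a| + 1 by rewrite ltr_wpDl.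
exists (Num.min d (e / (`|a| + 1))); first by rewrite /= lt_min d0 divr_gt0.
move=> u; rewrite /= in_itv/= andbT lt_min distrC => /andP[ud ue] u0.
have [->|ut] := eqVneq u t; first by rewrite subrr normr0.
have ut0 : u - t != 0 by rewrite subr_eq0.
have := hd _ ud ut0; rewrite addrC subrK => /(_ u0).
set q := _^-1 * _ => hq.
have qE : complex.Re (c * F u i j) - complex.Re (c * F t i j) = (u - t) * q by rewrite /q mulVKf.
rewrite distrC qE normrM.
have q_le : `|q| <= `|a| + 1.
  rewrite -[q](subKr a); apply: le_trans (ler_normB _ _) _.
  by rewrite lerD2l ltW.
apply: le_lt_trans (ler_wpM2l (normr_ge0 _) q_le) _.
by rewrite -ltr_pdivlMr.
Qed.

(** * Growth of the integrated remainders *)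

(** The parameter [d] of the interpolation is optimised for the logarithmic length of [s, t], so the
    primitive [P] depends on s and t while [M] does not. The [+ 1] collects the contributions that
    stay bounded. *)
Lemma remainder_primitive (R : realType) (k : nat) (c : R -> R) (c0 sigma sigma' : R) :
  1 < sigma -> sigma^-1 + sigma'^-1 = 1 ->
  {within `[0, +oo[, continuous c} -> (1 + t) ^+ k * c t @[t --> +oo] --> c0 ->
  (\int[lebesgue_measure]_(t in `[1%R, +oo[)
     (`|t ^+ k * c t - c0| `^ sigma / t)%:E < +oo)%E ->
  exists2 M : R, 0 <= M & forall s t : R, 0 <= s -> s <= t -> exists P P' : R -> R,
    (forall u : R, 0 <= u -> is_derive u 1 P (P' u) /\
       `|(1 + u) ^+ k * c u - c0| / (1 + u) <= P' u) /\
    P t - P s <= M * (ln ((1 + t) / (1 + s)) `^ sigma'^-1 + 1).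
Proof.
move=> s1 ss' cc lim_c int_c.
pose c' t := c (Num.max 0 t).
have c'E t : 0 <= t -> c' t = c t by move=> t0; rewrite /c' (max_idPr t0).
have lim_c' : (1 + t) ^+ k * c' t @[t --> +oo] --> c0.
  apply: cvg_trans lim_c; apply: near_eq_cvg; near=> t.
  by rewrite c'E//; near: t; exact: nbhs_pinfty_ge.
have int_c' : (\int[lebesgue_measure]_(t in `[1%R, +oo[)
     (`|t ^+ k * c' t - c0| `^ sigma / t)%:E < +oo)%E.
  apply: le_lt_trans int_c; rewrite le_eqVlt; apply/orP; left; apply/eqP.
  apply: eq_integral => t.
  by rewrite inE/= in_itv/= andbT => t1; rewrite c'E// (le_trans ler01).
have [F [F' [M [K [K0 hF]]]]] :=
  scaled_remainder_bound s1 (continuous_clamp cc) lim_c' int_c'.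
have M0 : 0 <= M by have [_ /andP[F0 FM] _] := hF 0 (lexx _); exact: le_trans FM.
exists (1 + M + K); first by rewrite !addr_ge0.
move=> s t s0 st; have t0 := le_trans s0 st.
have s1p : 0 < 1 + s by lra.
have t1p : 0 < 1 + t by lra.
have L0 : 0 <= ln ((1 + t) / (1 + s)).
  by rewrite ln_ge0// ler_pdivlMr// mul1r lerD2l.
have [d d0 hd] := interp_optimum s1 ss' L0 M0.
have d10 : 0 <= d `^ (1 - sigma) := powR_ge0 _ _.
(* A termwise primitive of the bound in [scaled_remainder_bound]; the last term integrates
   K/(1+u)^2. *)
pose P u := d * ln (1 + u) + d `^ (1 - sigma) * F u - K * (1 + u)^-1.
pose P' u := d / (1 + u) + d `^ (1 - sigma) * F' u + K / (1 + u) ^+ 2.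
exists P, P'; split.
  move=> u u0; have [dF _ hu] := hF u u0; split; last by rewrite -c'E//; exact: hu.
  have u1 : 1 + u != 0 by rewrite gt_eqF//; lra.
  have := is_deriveB (is_deriveD (is_deriveZ d (is_derive_ln1D u0))
    (is_deriveZ (d `^ (1 - sigma)) dF)) (is_deriveZ K (is_deriveV u1 (is_derive_1D u))).
  move/is_derive_eq; apply.
  by rewrite /P' /GRing.scale/= mulr1 mulrN opprK.
have [_ /andP[Fs0 _] _] := hF s s0; have [_ /andP[_ Ft] _] := hF t t0.
have -> : P t - P s = d * ln ((1 + t) / (1 + s)) + d `^ (1 - sigma) * (F t - F s) +
    K * ((1 + s)^-1 - (1 + t)^-1) by rewrite /P ln_div//; ring.
have F_le : d `^ (1 - sigma) * (F t - F s) <= d `^ (1 - sigma) * M.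
  by rewrite ler_wpM2l//; lra.
have K_le : K * ((1 + s)^-1 - (1 + t)^-1) <= K.
  rewrite ler_piMr//; apply: (@le_trans _ _ (1 + s)^-1).
    by rewrite lerBlDr lerDl invr_ge0 ltW.
  by rewrite invf_le1//; lra.
have X0 : 0 <= ln ((1 + t) / (1 + s)) `^ sigma'^-1 := powR_ge0 _ _.
apply: (@le_trans _ _ ((1 + M) * ln ((1 + t) / (1 + s)) `^ sigma'^-1 + M + K)).
  by apply: lerD K_le; apply: le_trans hd; rewrite lerD2l.
move: (ln _ `^ _) X0 => X X0.
rewrite [leRHS](_ : _ = (1 + M) * X + M + K + (1 + K * X)); last by ring.
by rewrite lerDl addr_ge0// mulr_ge0.
Unshelve. all: by end_near. Qed.

(** * Unit rotations and the reduction to the real system *)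

(** Rotating [z] onto the nonnegative real axis reduces the modulus of an entry to the real parts
    governed by the planar system. *)
Lemma norm_eq_Re (R : realType) (z : R[i]) :
  exists2 c : R[i], `|c| = 1 & `|z| = (complex.Re (c * z))%:C.
Proof.
have [->|z0] := eqVneq z 0.
  by exists 1; rewrite ?normr1// mulr0 normr0.
exists (`|z| / z); first by rewrite normrM normfV normr_id divff// normr_eq0.
by rewrite divfK// normc_def.
Qed.

Lemma mx_norm_le (R : realType) (m n : nat) (A : 'M[R[i]]_(m, n)) (B : R) : 0 <= B ->
  (forall i j, `|A i j| <= B%:C) -> `|A| <= B%:C.
Proof.
move=> B0 hA; have [A0|/mx_norm_neq0[[i j]]] := eqVneq (mx_norm A) 0.
  by rewrite /Num.norm/= A0 ler0c.
by rewrite [`|A|]/Num.norm/= => ->; exact: hA.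
Qed.

Lemma norm_i (R : realType) : `|'i%C : R[i]| = 1.
Proof. by rewrite normc_def /= expr0n/= add0r expr1n sqrtr1. Qed.

Lemma unit_sqr_le (R : realType) (c z : R[i]) : `|c| = 1 -> `|z| <= 1 ->
  complex.Re (c * z) ^+ 2 <= 1.
Proof.
move=> c1 z1; rewrite -real_normK ?num_real// expr_le1// -lecR.
by apply: le_trans (Re_normc_le _) _; rewrite normrM c1 mul1r.
Qed.

(** The factor i on the second row turns all coefficients of the system into real numbers, so real
    parts can be taken after multiplication by any [c]. The columns of the matrix do not
    interact. *)
Lemma real_system (R : realType) (n : nat) (b m : R -> R) (N b0 m0 : R)
    (t : R) (xi : 'rV[R]_n) (E D : 'M[R[i]]_2) (c : R[i]) (j : 'I_2) :
  0 < N ->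
  (1 + t)%:C *: D = (matA N b0 m0 + matR b m N b0 m0 t xi) *m E ->
  (1 + t) * complex.Re (c * D 0 j) =
    - complex.Re (c * E 0 j) + N * complex.Re (c * 'i%C * E 1 j) /\
  (1 + t) * complex.Re (c * 'i%C * D 1 j) =
    - (m0 / N + ((1 + t) ^+ 2 * enorm xi ^+ 2 + ((1 + t) ^+ 2 * m t - m0)) / N) *
      complex.Re (c * E 0 j) +
    (- b0 + (b0 - (1 + t) * b t)) * complex.Re (c * 'i%C * E 1 j).
Proof.
move=> N0 /matrixP eqE; have N00 : N != 0 by rewrite gt_eqF.
have := eqE 0 j; have := eqE 1 j; rewrite !mxE !big_ord_recl !big_ord0 !mxE /=.
have -> : lift ord0 ord0 = 1 :> 'I_2 by apply/val_inj.
rewrite !addr0 /=.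
rewrite -[ord0]/(0 : 'I_2); have -> : N%:C^-1 = N^-1%:C :> R[i] by rewrite fmorphV.
move: (D 1 j) (D 0 j) (E 0 j) (E 1 j) => d1 d0 e0 e1 eq1 eq0.
have ReM (a : R) z : a * complex.Re z = complex.Re (a%:C * z).
  by case: z => z1 z2 /=; ring.
rewrite !ReM ![(1 + t)%:C * (_ * _)]mulrCA eq0 eq1.
case: c e0 e1 {eq0 eq1} => [c1 c2] [a1 a2] [a3 a4]; split; simpc => /=; by field.
Qed.

Theorem theorem2p2 (R : realType) (n : nat) (b m : R -> R)
    (sigma sigma' b0 m0 N : R) (E : R -> R -> 'rV[R]_n -> 'M[R[i]]_2)
    (hb : {within `[0, +oo[, continuous b})
    (hm : {within `[0, +oo[, continuous m})
    (hsigma : 1 < sigma <= 2)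
    (hsigma' : sigma^-1 + sigma'^-1 = 1)
    (hb0 : (1 + t) * b t @[t --> +oo] --> b0)
    (hm0 : (1 + t) ^+ 2 * m t @[t --> +oo] --> m0)
    (hbint : (\int[lebesgue_measure]_(t in `[1%R, +oo[)
                (`|t * b t - b0| `^ sigma / t)%:E < +oo)%E)
    (hmint : (\int[lebesgue_measure]_(t in `[1%R, +oo[)
                (`|t ^+ 2 * m t - m0| `^ sigma / t)%:E < +oo)%E)
    (hdisc : 4 * m0 < (b0 - 1) ^+ 2)
    (hN : 0 < N)
    (hE : fundamental_solution b m N b0 m0 E) :
  let mu_plus := - ((b0 + 1) / 2) + Num.sqrt ((b0 - 1) ^+ 2 / 4 - m0) in
  exists C C' : R, [/\ 0 < C, 0 < C' &
    forall (s t : R) (xi : 'rV[R]_n),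
      0 <= s -> s <= t -> (1 + t) * enorm xi <= N ->
      `|E t s xi| <=
        (C' * ((1 + t) / (1 + s)) `^ mu_plus
            * expR (C * ln ((1 + t) / (1 + s)) `^ sigma'^-1))%:C].

Proof.
(* [D] is half the gap between the two eigenvalues, so [mu - 2 * D] is mu_-. *)
set D := Num.sqrt _ => mu.
have disc0 : 0 < (b0 - 1) ^+ 2 / 4 - m0 by lra.
have D0 : 0 < D by rewrite sqrtr_gt0.
have DD : D ^+ 2 = (b0 - 1) ^+ 2 / 4 - m0 by rewrite sqr_sqrtr// ltW.
have mu_lt : mu - 2 * D < mu by lra.
have mu_tr : mu + (mu - 2 * D) = - (b0 + 1) by rewrite /mu; lra.
have mu_det : mu * (mu - 2 * D) = b0 + m0.
  have -> : mu * (mu - 2 * D) = ((b0 + 1) / 2) ^+ 2 - D ^+ 2 by rewrite /mu; field.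
  by rewrite DD; field.
have [K [L [K0 L0 hKL]]] := planar_system_bound hN mu_lt mu_tr mu_det.
have /andP[sigma1 _] := hsigma.
have [Mb Mb0 hMb] := @remainder_primitive R 1 b b0 _ _ sigma1 hsigma' hb hb0 hbint.
have [Mm Mm0 hMm] := @remainder_primitive R 2 m m0 _ _ sigma1 hsigma' hm hm0 hmint.
pose M := Mm / N + Mb.
have M0 : 0 <= M by rewrite addr_ge0// divr_ge0// ltW.
(* The summand 1 keeps the first constant positive if [M] vanishes. The second constant absorbs the
   bounded part of the exponent, and its factor 2 dominates the square root of 2 coming from the
   initial data. *)
exists (L * (M + 1)), (2 * K * expR (L * (N / 2 + M))); split.
- by rewrite mulr_gt0// ltr_wpDl.
- by rewrite !mulr_gt0// expR_gt0.
move=> s t xi s0 st xiN; have t0 := le_trans s0 st.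
have s1 : 0 < 1 + s by lra.
have t1 : 0 < 1 + t by lra.
have [Es] := hE s xi s0.
set F := fun tau => E tau s xi => hF.
have /boolp.choice[dF hdF] : forall u, exists dFu : 'M[R[i]]_2, 0 <= u ->
    is_deriv_half_line F u dFu /\
    (1 + u)%:C *: dFu = (matA N b0 m0 + matR b m N b0 m0 u xi) *m F u.
  move=> u; have [u0|u0] := boolP (0 <= u); last by exists 0.
  by have [dFu h1 h2] := hF u u0; exists dFu.
have [Pb [Pb' [hPb Pbst]]] := hMb s t s0 st.
have [Pm [Pm' [hPm Pmst]]] := hMm s t s0 st.
pose z := enorm xi ^+ 2.
(* The first term is a primitive of the xi part of the remainder divided by 1+u; the others come
   from [m] and [b]. *)
pose H u := z / (2 * N) * (1 + u) ^+ 2 + (N^-1 * Pm u + Pb u).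
pose H' u := z / N * (1 + u) + (N^-1 * Pm' u + Pb' u).
have dH (u : R) : 0 <= u -> is_derive u 1 H (H' u).
  move=> u0; have [dPm _] := hPm u u0; have [dPb _] := hPb u u0.
  have := is_deriveD (is_deriveZ (z / (2 * N)) (is_derive_sqr (is_derive_1D u)))
    (is_deriveD (is_deriveZ N^-1 dPm) dPb).
  move/is_derive_eq; apply; rewrite /H' /GRing.scale/=; field.
  by rewrite gt_eqF.
set Lg := ln ((1 + t) / (1 + s)) `^ sigma'^-1 in Pbst Pmst *.
have Lg0 : 0 <= Lg by exact: powR_ge0.
have Hst : H t - H s <= N / 2 + M * (Lg + 1).
  (* The zone condition at the final time bounds the increment of the xi term by N/2. *)
  have zN : z * (1 + t) ^+ 2 <= N ^+ 2.
    rewrite /z -exprMn mulrC lerXn2r// ?nnegrE ?(ltW hN)//.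
    by rewrite mulr_ge0 ?(ltW t1)// sqrtr_ge0.
  have zs : 0 <= z * (1 + s) ^+ 2 by rewrite mulr_ge0 ?sqr_ge0.
  have -> : H t - H s = (z * (1 + t) ^+ 2 - z * (1 + s) ^+ 2) / (2 * N) +
      (N^-1 * (Pm t - Pm s) + (Pb t - Pb s)) by rewrite /H; field; rewrite gt_eqF.
  apply: lerD.
    rewrite ler_pdivrMr ?mulr_gt0// (_ : N / 2 * (2 * N) = N ^+ 2); last by field.
    by apply: le_trans zN; rewrite gerBl.
  rewrite (_ : M * (Lg + 1) = N^-1 * (Mm * (Lg + 1)) + Mb * (Lg + 1)); last first.
    by rewrite /M; ring.
  by apply: lerD Pbst; rewrite ler_wpM2l// invr_ge0 ltW.
have key c j : `|c| = 1 ->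
    complex.Re (c * E t s xi 0 j) ^+ 2 + complex.Re (c * 'i%C * E t s xi 1 j) ^+ 2 <=
    (K * ((1 + t) / (1 + s)) `^ mu * expR (L * (H t - H s))) ^+ 2 * 2.
  move=> c1; have ci1 : `|c * 'i%C| = 1 by rewrite normrM c1 norm_i mulr1.
  have sub : `[s, t] `<=` (`[0, +oo[ : set R).
    by move=> u /=; rewrite !in_itv/= andbT => /andP[su _]; exact: le_trans su.
  have cF (e : R[i]) k l : `|e| = 1 ->
      {within `[s, t], continuous (fun u => complex.Re (e * F u k l))}.
    move=> e1; apply: continuous_subspaceW sub _.
    by apply: (half_line_continuous (D := dF)) => // u /hdF[].
  have := hKL (fun u => complex.Re (c * F u 0 j)) (fun u => complex.Re (c * 'i%C * F u 1 j)) H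
    (fun u => complex.Re (c * dF u 0 j)) (fun u => complex.Re (c * 'i%C * dF u 1 j)) H'
    (fun u => ((1 + u) ^+ 2 * z + ((1 + u) ^+ 2 * m u - m0)) / N)
    (fun u => b0 - (1 + u) * b u) s t s0 st (cF _ _ _ c1) (cF _ _ _ ci1).
  have cH : {within `[s, t], continuous H}.
    apply: derivable_within_continuous => u; rewrite in_itv/= => /andP[su _].
    by have [] := dH u (le_trans s0 su).
  move=> /(_ cH) h; apply: le_trans (h _ _) _.
  - move=> u sut; have u0 : 0 < u by lra.
    have [hd _] := hdF u (ltW u0).
    by split; [exact: half_line_is_derive | exact: half_line_is_derive | exact/dH/ltW].
  - move=> u sut; have u0 : 0 <= u by lra.
    have [_ eq_u] := hdF u u0; have [e1 e2] := real_system c j hN eq_u.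
    split=> //.
    have [_ hb_u] := hPb u u0; have [_ hm_u] := hPm u u0.
    have u1 : 0 < 1 + u by lra.
    rewrite (distrC b0) [leLHS]mulrDl /H' [leRHS]addrA; apply: lerD hb_u.
    apply: (@le_trans _ _ (((1 + u) ^+ 2 * z + `|(1 + u) ^+ 2 * m u - m0|) / N / (1 + u))).
      rewrite ler_wpM2r ?invr_ge0 ?(ltW u1)// normrM [`|N^-1|]gtr0_norm ?invr_gt0//.
      rewrite ler_wpM2r ?invr_ge0 ?(ltW hN)//; apply: le_trans (ler_normD _ _) _.
      by rewrite lerD2r ger0_norm// mulr_ge0 ?sqr_ge0.
    rewrite [leLHS](_ : _ = z / N * (1 + u) +
      N^-1 * (`|(1 + u) ^+ 2 * m u - m0| / (1 + u))); last by field; rewrite !gt_eqF.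
    by rewrite lerD2l ler_wpM2l ?invr_ge0 ?(ltW hN).
  (* At time s the entries are those of the identity matrix, so each of the two squares is at most
     1. *)
  rewrite ler_wpM2l ?sqr_ge0// /F Es !mxE.
  by rewrite -[2]/(1 + 1) lerD// unit_sqr_le//; case: eqP => _; rewrite ?normr1 ?normr0.
set B := (X in X%:C).
have B0 : 0 <= B by rewrite /B !mulr_ge0 ?expR_ge0 ?powR_ge0// ltW.
have leB : (K * ((1 + t) / (1 + s)) `^ mu * expR (L * (H t - H s))) ^+ 2 * 2 <= B ^+ 2.
  set Q := _ `^ mu; have Q0 : 0 <= Q by exact: powR_ge0.
  apply: (@le_trans _ _ ((2 * (K * Q * expR (L * (H t - H s)))) ^+ 2)).
    by rewrite [leRHS]exprMn [leLHS]mulrC ler_wpM2r ?sqr_ge0// expr2; lra.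
  rewrite lerXn2r ?nnegrE// ?mulr_ge0 ?expR_ge0 ?(ltW K0)//.
  have -> : B = 2 * (K * Q * expR (L * (N / 2 + M) + L * (M + 1) * Lg)).
    by rewrite expRD /B -/Lg -/Q; ring.
  rewrite ler_pM2l// ler_wpM2l ?mulr_ge0 ?(ltW K0)// ler_expR.
  rewrite [leRHS](_ : _ = L * (N / 2 + M * (Lg + 1) + Lg)); last by ring.
  by rewrite ler_pM2l//; apply: le_trans Hst _; rewrite lerDl.
apply: mx_norm_le => // i j; have [c c1 ->] := norm_eq_Re (E t s xi i j).
rewrite lecR; apply: le_trans (ler_norm _) _.
rewrite -(@ler_pXn2r _ 2)// real_normK ?num_real//; apply: le_trans leB.
have [->|->] : i = 0 \/ i = 1.
  by case: i => [[|[|//]] ?]; [left|right]; exact: val_inj.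
- by apply: le_trans (key c j c1); rewrite lerDl sqr_ge0.
(* For the second row, rotating by -i c cancels the factor i built into the second real unknown. *)
have ci1 : `|c * - 'i%C| = 1 by rewrite normrM normrN c1 norm_i mulr1.
apply: le_trans (key _ j ci1); rewrite -[c * _ * 'i%C]mulrA mulNr -expr2 sqr_i opprK mulr1.
by rewrite lerDr sqr_ge0.
Qed.
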